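(* Let $X$ be a graph and let $a$ and $b$ be strongly cospectral vertices of $X$. Then every automorphism of $X$ that fixes $a$ also fixes $b$.
   Context: Graphs are finite, simple and undirected. Let $A$ be the adjacency matrix of $X$, with rows and columns indexed by the vertex set $V(X)$, and let $e_a$ ($a\in V(X)$) be the standard basis vectors of $\mathbb{R}^{V(X)}$. Let $\theta_1,\ldots,\theta_m$ be the distinct eigenvalues of $A$, and let $E_r$ be the matrix representing orthogonal projection onto the $\theta_r$-eigenspace, so $A=\sum_r\theta_rE_r$. Vertices $a$ and $b$ are strongly cospectral if for each $r$ we have $E_re_a=E_re_b$ or $E_re_a=-E_re_b$. *)

(* Defs.v *)
From mathcomp Require Import all_boot all_order all_fingroup all_algebra.
From mathcomp Require Export reals.

Set Implicit Arguments.
Unset Strict Implicit.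
Unset Printing Implicit Defensive.

Import Order.TTheory GRing.Theory Num.Theory.
Local Open Scope ring_scope.

Record sgraph := SGraph {
  vertex :> finType;
  adj : rel vertex;
  adj_sym : symmetric adj;
  adj_irr : irreflexive adj }.

Definition automorphism (X : sgraph) (g : {perm X}) : Prop :=
  forall x y : X, adj (g x) (g y) = adj x y.

(* Coordinates are indexed by V(X) through the bijection enum_rank with
   'I_#|X|.  Vectors are rows and matrices act on the right, as in mxalgebra;
   adjmx and orthoproj are symmetric (adjmx_sym, orthoproj_sym), so this agrees
   with the action on columns up to transposition. *)
Section AdjacencySpectrum.
Variable R : realType.

Definition adjmx (X : sgraph) : 'M[R]_#|X| :=
  \matrix_(i, j) (adj (enum_val i : X) (enum_val j))%:R.

Definition evec (X : sgraph) (a : X) : 'rV[R]_#|X| := delta_mx 0 (enum_rank a).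

(* The projection onto the row space of U along its orthogonal complement for
   the standard inner product. *)
Definition orthoproj n (U : 'M[R]_n) : 'M[R]_n :=
  proj_mx U (orthomx idfun 1%:M U).

Definition eigenproj (X : sgraph) (theta : R) : 'M[R]_#|X| :=
  orthoproj (eigenspace (adjmx X) theta).

Definition strongly_cospectral (X : sgraph) (a b : X) : Prop :=
  forall theta : R, eigenvalue (adjmx X) theta ->
    evec a *m eigenproj X theta = evec b *m eigenproj X theta \/
    evec a *m eigenproj X theta = - (evec b *m eigenproj X theta).

Lemma adjmx_sym (X : sgraph) : (adjmx X)^T = adjmx X.
Proof. by apply/matrixP => i j; rewrite !mxE adj_sym. Qed.

Lemma sub_orthomx1 m n (U : 'M[R]_n) (W : 'M[R]_(m, n)) :
  (W <= orthomx idfun 1%:M U)%MS = (W *m U^T == 0).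
Proof. by rewrite /orthomx sub_kermx mul1mx map_mx_id. Qed.

Lemma mulmx_tr_eq0 n (v : 'rV[R]_n) : v *m v^T = 0 -> v = 0.
Proof.
move/matrixP/(_ 0 0); rewrite !mxE => /eqP.
rewrite psumr_eq0 => [/allP v0|i _]; last by rewrite mxE -expr2 sqr_ge0.
apply/rowP => i; have := v0 i (mem_index_enum i).
by rewrite !mxE -expr2 sqrf_eq0 => /eqP.
Qed.

Lemma capmx_ortho n (U : 'M[R]_n) : (U :&: orthomx idfun 1%:M U = 0)%MS.
Proof.
apply/eqP/rowV0P => v; rewrite sub_capmx sub_orthomx1 => /andP[/submxP[w ->]].
move=> /eqP wUU; apply: mulmx_tr_eq0.
by rewrite trmx_mul mulmxA wUU mul0mx.
Qed.

Lemma orthoproj_sub m n (U : 'M[R]_n) (W : 'M[R]_(m, n)) :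
  (W *m orthoproj U <= U)%MS.
Proof. exact: proj_mx_sub. Qed.

Lemma orthoproj_id m n (U : 'M[R]_n) (W : 'M[R]_(m, n)) :
  (W <= U)%MS -> W *m orthoproj U = W.
Proof. exact/proj_mx_id/capmx_ortho. Qed.

Lemma orthoproj_0 m n (U : 'M[R]_n) (W : 'M[R]_(m, n)) :
  W *m U^T = 0 -> W *m orthoproj U = 0.
Proof.
by move=> WU; apply: proj_mx_0; rewrite ?capmx_ortho // sub_orthomx1 WU.
Qed.

Lemma orthoproj_sym n (U : 'M[R]_n) : (orthoproj U)^T = orthoproj U.
Proof.
have UT p (W : 'M[R]_(p, n)) : (W - W *m orthoproj U) *m U^T = 0.
  have sub1 : (W <= U + orthomx idfun 1%:M U)%MS.
    apply: submx_full; rewrite /row_full eqn_leq rank_leq_col /=.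
    rewrite (mxrank_disjoint_sum (capmx_ortho U)) /orthomx mxrank_ker.
    by rewrite mul1mx map_mx_id // mxrank_tr subnKC ?rank_leq_row.
  by apply/eqP; rewrite -sub_orthomx1 proj_mx_compl_sub.
have EE : orthoproj U = orthoproj U *m (orthoproj U)^T.
  have /submxP[D eD] : (orthoproj U <= U)%MS.
    by rewrite -[orthoproj U]mul1mx orthoproj_sub.
  have := UT _ 1%:M; rewrite mul1mx => /(congr1 (mulmx^~ D^T)).
  rewrite mul0mx -mulmxA -trmx_mul -eD mulmxBl mul1mx => /eqP.
  by rewrite subr_eq0 => /eqP H; rewrite -H -[LHS]trmxK H trmx_mul trmxK.
by rewrite EE trmx_mul trmxK.
Qed.

End AdjacencySpectrum.
Arguments eigenproj {R} X theta.

(* Main.v *)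
Require Import Defs.
From mathcomp Require Import all_boot all_order all_fingroup all_algebra.
From mathcomp Require Import spectral complex.

(** An automorphism [g] permutes the coordinates of each eigenvector [u] of the
    adjacency matrix into an eigenvector [u \o g] for the same eigenvalue.
    Since [g] fixes [a], the eigenvector [w = u \o g - u] has coordinate [0] at
    [a].  Strong cospectrality transports this to [b]: pairing [e_a] or [e_b]
    with an eigenvector only sees the projection onto its eigenspace, and these
    two projections agree up to sign ([strongly_cospectral_coord]).  Hence
    [u (g b) = u b] for every eigenvector [u].

    The adjacency matrix is real symmetric, so by the spectral theorem
    ([symmetric_sum_eigenspace]) its eigenvectors span the whole space, and the
    linear functional [u |-> u (g b) - u b] is zero.  Evaluating it at [e_b]
    gives [g b = b]. *)

Set Implicit Arguments.
Unset Strict Implicit.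
Unset Printing Implicit Defensive.

Import Order.TTheory GRing.Theory Num.Theory.
Local Open Scope ring_scope.

(** The matrix is Hermitian over [R[i]], hence unitarily diagonalizable there
    with real eigenvalues [(d i)%:C].  The eigenspaces for real eigenvalues are
    already defined over [R], and extending scalars does not change ranks, so
    the real eigenspaces span as well. *)
Lemma symmetric_sum_eigenspace (R : rcfType) n (A : 'M[R]_n) :
  A^T = A -> exists d : 'I_n -> R, row_full (\sum_i eigenspace A (d i))%MS.
Proof.
move=> symA; pose f : {rmorphism R -> complex R} := real_complex R; pose B := map_mx f A.
have hermB : B \is hermsymmx.
  apply: realsym_hermsym.
    apply/is_hermitianmxP.
    rewrite expr0 scale1r map_mx_id //.
    by rewrite /B map_trmx symA.
  by apply/mxOverP => i j; rewrite mxE; apply/complex_realP; exists (A i j).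
have defB := orthomx_spectralP (hermitian_normalmx hermB).
have /mxOverP realD := hermitian_spectral_diag_real hermB.
set P := spectralmx B in defB; set D := spectral_diag B in defB realD.
have unitP : P \in unitmx by exact: spectral_unit.
exists (fun i => complex.Re (D 0 i)).
have fD i : f (complex.Re (D 0 i)) = D 0 i.
  by have /complex_realP[x ->] := realD 0 i.
rewrite -(row_full_map f) -sub1mx.
apply: submx_trans (_ : P <= _)%MS; first by rewrite sub1mx row_full_unit.
apply/row_subP => i; apply: (@submx_trans _ _ _ _ _ _ (eigenspace B (D 0 i))).
  apply/eigenspaceP.
  by rewrite {1}defB rowE !mulmxA mulmxK // -(rowE i (diag_mx D)) row_diag_mx -scalemxAl.
by rewrite -fD -map_eigenspace map_submx (sumsmx_sup i).
Qed.

(** A linear functional is determined on eigenvectors, as these span. *)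
Lemma eigenvector_functional_eq0 (R : rcfType) n (A : 'M[R]_n) (c : 'cV_n) :
    A^T = A ->
    (forall theta (u : 'rV_n), u *m A = theta *: u -> u *m c = 0) ->
  c = 0.
Proof.
move=> /symmetric_sum_eigenspace[d]; rewrite -sub1mx => sub1 c0.
suff /submx_trans/(_ _)/sub_kermxP: (1%:M <= kermx c)%MS.
  by move=> /(_ _ _ (submx_refl _)); rewrite mul1mx.
apply: submx_trans sub1 _; apply/sumsmx_subP => i _.
apply/row_subP => j; apply/sub_kermxP/(c0 (d i))/eigenspaceP/row_sub.
Qed.

Section StronglyCospectral.
Variables (R : realType) (X : sgraph).
Implicit Types (a b : X) (u : 'rV[R]_#|X|) (g : {perm X}).

(** The projection is symmetric and fixes [u], so the coordinate of [u] at [c]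
    is the inner product of [u] with the projection of [evec c]. *)
Lemma eigenvector_coord theta u (c : X) :
    u *m adjmx R X = theta *: u ->
  u 0 (enum_rank c) = (evec R c *m eigenproj X theta *m u^T) 0 0.
Proof.
move=> /eigenspaceP/orthoproj_id uE.
rewrite -mulmxA -[eigenproj X theta]orthoproj_sym -trmx_mul uE.
by rewrite -rowE !mxE.
Qed.

(** The projections of [evec a] and [evec b] agree up to sign, hence so do the
    coordinates at [a] and [b]; the vanishing of one forces that of the other
    whichever sign occurs. *)
Lemma strongly_cospectral_coord a b theta u :
    strongly_cospectral R a b -> u *m adjmx R X = theta *: u ->
  u 0 (enum_rank a) = 0 -> u 0 (enum_rank b) = 0.
Proof.
move=> hab eig_u; rewrite !(eigenvector_coord _ eig_u).
have [->|u_neq0] := eqVneq u 0; first by rewrite trmx0 !mulmx0 !mxE.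
have /hab[->|->] // : eigenvalue (adjmx R X) theta.
  by apply/eigenvalueP; exists u.
by rewrite mulNmx mxE => /eqP; rewrite oppr_eq0 => /eqP.
Qed.

Definition act_row g u : 'rV[R]_#|X| :=
  \row_j u 0 (enum_rank (g (enum_val j))).

(** The permutation matrix of an automorphism commutes with [adjmx R X]. *)
Lemma automorphism_eigenvector g theta u :
    automorphism g -> u *m adjmx R X = theta *: u ->
  act_row g u *m adjmx R X = theta *: act_row g u.
Proof.
move=> hg eig_u; apply/rowP => k.
have /rowP/(_ (enum_rank (g (enum_val k)))) := eig_u.
rewrite !mxE => <-.
rewrite [RHS](reindex (fun j : 'I_#|X| => enum_rank (g (enum_val j)))) /=.
  by apply: eq_bigr => j _; rewrite !mxE !enum_rankK hg.
exists (fun j : 'I_#|X| => enum_rank (g^-1%g (enum_val j))) => j _.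
  by rewrite enum_rankK permK enum_valK.
by rewrite enum_rankK permKV enum_valK.
Qed.

End StronglyCospectral.

Theorem corollary6p4 (R : realType) (X : sgraph) (a b : X)
    (hab : strongly_cospectral R a b)
    (g : {perm X}) (hg : automorphism g) :
  g a = a -> g b = b.
Proof.
move=> ga.
(* [u *m c] is the functional [u |-> u (g b) - u b]. *)
pose c : 'cV[R]_#|X| := (evec R (g b) - evec R b)^T.
have cE (u : 'rV[R]_#|X|) :
    u *m c = (u 0 (enum_rank (g b)) - u 0 (enum_rank b))%:M.
  rewrite [LHS]mx11_scalar -[u *m c]trmxK trmx_mul trmxK mulmxBl.
  by rewrite -!rowE !mxE.
have c0 : c = 0.
  apply: (eigenvector_functional_eq0 (adjmx_sym R X)) => theta u eig_u.
  have eig_w : (act_row g u - u) *m adjmx R X = theta *: (act_row g u - u).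
    by rewrite mulmxBl (automorphism_eigenvector hg eig_u) eig_u scalerBr.
  have := strongly_cospectral_coord hab eig_w.
  by rewrite cE !mxE !enum_rankK ga subrr => ->; rewrite ?raddf0.
have := cE (evec R b); rewrite c0 mulmx0 => /matrixP/(_ 0 0)/eqP.
rewrite !mxE !eqxx /= mulr1n (inj_eq enum_rank_inj).
case: (eqVneq (g b) b) => //= _.
by rewrite sub0r eq_sym oppr_eq0 oner_eq0.
Qed.
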